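(* Let $\mathbb K$ be a field of characteristic $0$ and let $V$ be a finite-dimensional vector space over $\mathbb K$ with $\dim V\ge 2$. Then there exist at most three mutually adjacent Leonard pairs on $V$.
   Context: A square matrix is tridiagonal if each nonzero entry lies on the diagonal, subdiagonal or superdiagonal; a tridiagonal matrix is irreducible if all its subdiagonal entries and all its superdiagonal entries are nonzero. A square matrix is lower bidiagonal if each nonzero entry lies on the diagonal or the subdiagonal, and upper bidiagonal if its transpose is lower bidiagonal. Bases are ordered. A Leonard pair on $V$ is an ordered pair $(A,A^* )$ of linear maps $A,A^*:V\to V$ such that (i) there is a basis of $V$ with respect to which $A$ is diagonal and $A^*$ is irreducible tridiagonal, and (ii) there is a basis of $V$ with respect to which $A^*$ is diagonal and $A$ is irreducible tridiagonal. ($A^*$ is just a name; no adjoint is meant.) A basis as in (i) is called $A$-standard, a basis as in (ii) is called $A^*$-standard, and a basis is standard for $(A,A^* )$ if it is $A$-standard or $A^*$-standard. A basis is split for $(A,A^* )$ if with respect to it one of $A,A^*$ is lower bidiagonal and the other is upper bidiagonal. Leonard pairs $(A,A^* )$ and $(B,B^* )$ on $V$ are adjacent if every basis that is standard for $(A,A^* )$ is split for $(B,B^* )$ and every basis that is standard for $(B,B^* )$ is split for $(A,A^* )$. Leonard pairs are mutually adjacent if any two of them are adjacent. *)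

(* Defs.v *)
From HB Require Import structures.
From mathcomp Require Import all_boot all_order all_algebra.

Set Implicit Arguments.
Unset Strict Implicit.
Unset Printing Implicit Defensive.

Import GRing.Theory.
Local Open Scope ring_scope.

Definition tridiagonal (K : fieldType) (n : nat) (M : 'M[K]_n) : Prop :=
  forall i j : 'I_n, M i j != 0 ->
    [|| i == j :> nat, i == j.+1 :> nat | j == i.+1 :> nat].

Definition irreducible_tridiagonal (K : fieldType) (n : nat) (M : 'M[K]_n) :
  Prop :=
  [/\ tridiagonal M,
      forall i j : 'I_n, i = j.+1 :> nat -> M i j != 0
    & forall i j : 'I_n, j = i.+1 :> nat -> M i j != 0].

Definition lower_bidiagonal (K : fieldType) (n : nat) (M : 'M[K]_n) : Prop :=
  forall i j : 'I_n, M i j != 0 -> (i == j :> nat) || (i == j.+1 :> nat).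

Definition upper_bidiagonal (K : fieldType) (n : nat) (M : 'M[K]_n) : Prop :=
  lower_bidiagonal M^T.

(* Column convention: A e_j = \sum_i repr_mx e A i j *: e_i when e is a basis. *)
Definition repr_mx (K : fieldType) (V : vectType K)
    (e : (\dim {:V}).-tuple V) (A : 'End(V)) : 'M[K]_(\dim {:V}) :=
  \matrix_(i, j) coord e i (A e`_j).

(* In the definitions below a pair p of endomorphisms stands for
   (A, A^* ) = (p.1, p.2). *)
Definition A_standard (K : fieldType) (V : vectType K)
    (p : 'End(V) * 'End(V)) (e : (\dim {:V}).-tuple V) : Prop :=
  [/\ basis_of {:V} e,
      is_diag_mx (repr_mx e p.1)
    & irreducible_tridiagonal (repr_mx e p.2)].

Definition Astar_standard (K : fieldType) (V : vectType K)
    (p : 'End(V) * 'End(V)) (e : (\dim {:V}).-tuple V) : Prop :=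
  [/\ basis_of {:V} e,
      is_diag_mx (repr_mx e p.2)
    & irreducible_tridiagonal (repr_mx e p.1)].

Definition leonard_pair (K : fieldType) (V : vectType K)
    (p : 'End(V) * 'End(V)) : Prop :=
  (exists e, A_standard p e) /\ (exists e, Astar_standard p e).

Definition standard (K : fieldType) (V : vectType K)
    (p : 'End(V) * 'End(V)) (e : (\dim {:V}).-tuple V) : Prop :=
  A_standard p e \/ Astar_standard p e.

Definition split_basis (K : fieldType) (V : vectType K)
    (p : 'End(V) * 'End(V)) (e : (\dim {:V}).-tuple V) : Prop :=
  basis_of {:V} e /\
  (lower_bidiagonal (repr_mx e p.1) /\ upper_bidiagonal (repr_mx e p.2) \/
   upper_bidiagonal (repr_mx e p.1) /\ lower_bidiagonal (repr_mx e p.2)).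

Definition adjacent (K : fieldType) (V : vectType K)
    (p q : 'End(V) * 'End(V)) : Prop :=
  (forall e, standard p e -> split_basis q e) /\
  (forall e, standard q e -> split_basis p e).

Definition mutually_adjacent (K : fieldType) (V : vectType K)
    (s : seq ('End(V) * 'End(V))) : Prop :=
  forall p q, p \in s -> q \in s -> p != q -> adjacent p q.

(* Main.v *)
Require Import Defs.
From mathcomp Require Import all_boot all_order all_algebra.

(** A Leonard pair [(A, A')] singles out four distinct lines: the two ends of
    an [A]-standard basis and the two ends of an [A']-standard basis.  Hence
    it determines a perfect matching of these four lines.  A basis in which a
    Leonard pair [(B, B')] is split starts with an end of a standard basis of
    one kind for [(B, B')] and finishes with an end of the other kind.
    Therefore adjacent Leonard pairs have the same four lines but matchings
    without a common edge, and four points admit only three perfect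
    matchings. *)

Set Implicit Arguments.
Unset Strict Implicit.

Local Open Scope ring_scope.
Import GRing.Theory.

(** * Coordinates and diagonal maps *)

Lemma coord_repr_mx (K : fieldType) (V : vectType K) (e : (\dim {:V}).-tuple V)
    (A : 'End(V)) (v : V) (j : 'I_(\dim {:V})) : basis_of {:V} e ->
  coord e j (A v) = \sum_i repr_mx e A j i * coord e i v.
Proof.
move=> be; rewrite {1}(coord_basis be (memvf v)) !linear_sum.
by apply: eq_bigr => i _; rewrite !linearZ mxE /= mulrC.
Qed.

Lemma coord_diag (K : fieldType) (V : vectType K) (e : (\dim {:V}).-tuple V)
    (A : 'End(V)) (v : V) (j : 'I_(\dim {:V})) :
    basis_of {:V} e -> is_diag_mx (repr_mx e A) ->
  coord e j (A v) = repr_mx e A j j * coord e j v.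
Proof.
move=> be /is_diag_mxP dA; rewrite coord_repr_mx // (bigD1 j) //=.
by rewrite big1 ?addr0 // => i ij; rewrite dA ?mul0r // eq_sym.
Qed.

Lemma basis_ext (K : fieldType) (V : vectType K) (e : (\dim {:V}).-tuple V)
    (u v : V) : basis_of {:V} e ->
  (forall j, coord e j u = coord e j v) -> u = v.
Proof.
move=> be uv; rewrite (coord_basis be (memvf u)) (coord_basis be (memvf v)).
by apply: eq_bigr => i _; rewrite uv.
Qed.

Lemma basis_neq0 (K : fieldType) (V : vectType K) (e : (\dim {:V}).-tuple V)
    (i : 'I_(\dim {:V})) : basis_of {:V} e -> e`_i != 0.
Proof.
move=> be; apply/eqP => ei0; have := coord_free i i (basis_free be).
by rewrite ei0 linear0 eqxx => /eqP; rewrite eq_sym oner_eq0.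
Qed.

Lemma diag_basis (K : fieldType) (V : vectType K) (e : (\dim {:V}).-tuple V)
    (A : 'End(V)) (i : 'I_(\dim {:V})) : basis_of {:V} e ->
  is_diag_mx (repr_mx e A) -> A e`_i = repr_mx e A i i *: e`_i.
Proof.
move=> be dA; apply: (basis_ext be) => j; rewrite coord_diag // linearZ /=.
by rewrite coord_free ?(basis_free be) //; case: eqP => [->|]; rewrite ?mulr0.
Qed.

Lemma line_eq (K : fieldType) (V : vectType K) (u v : V) : v != 0 ->
    (exists c, v = c *: u) -> <[v]>%VS = <[u]>%VS.
Proof.
move=> v0 [c vE]; apply/eqP; rewrite eqEdim; apply/andP; split.
  by rewrite -memvE; apply/vlineP; exists c.
by rewrite !dim_vline v0; case: (u != 0).
Qed.

(** * Eigenspaces of irreducible tridiagonal maps *)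

(** Nonzero superdiagonal entries turn the eigenvector equation into a recursion that determines
    every coordinate from the zeroth. *)
Lemma irreducible_tridiagonal_eigen0 (K : fieldType) (V : vectType K)
    (e : (\dim {:V}).-tuple V) (B : 'End(V)) (v : V) (a : K)
    (i0 : 'I_(\dim {:V})) :
    basis_of {:V} e -> irreducible_tridiagonal (repr_mx e B) ->
    B v = a *: v -> i0 = 0%N :> nat -> coord e i0 v = 0 -> v = 0.
Proof.
move=> be [tB _ sB] Bv i00 v0; apply: (basis_ext be) => j; rewrite linear0.
have [m] := ubnP (j : nat); elim: m j => // m IHm j; rewrite ltnS => jm.
case j_def: (j : nat) => [|k].
  by rewrite (_ : j = i0) //; apply: val_inj; rewrite /= j_def.
have kn : (k < \dim {:V})%N by apply: leq_trans (ltn_ord j); rewrite j_def.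
pose k' := Ordinal kn.
(* In row [k'] the terms up to index [k] vanish by induction and those beyond [j] by tridiagonality;
   the superdiagonal entry times the coordinate at [j] remains. *)
have := congr1 (coord e k') Bv; rewrite coord_repr_mx // linearZ /=.
rewrite (IHm k') ?mulr0; last by rewrite -ltnS -j_def.
rewrite (bigD1 j) //= big1 ?addr0; last first.
  move=> i ij; have [ik|ki] := leqP i k.
    by rewrite (IHm i) ?mulr0 // (leq_ltn_trans ik) // -ltnS -j_def.
  have [->|/tB /=] := eqVneq (repr_mx e B k' i) 0; first by rewrite mul0r.
  rewrite ltn_eqF // [k == _]ltn_eqF ?(ltnW ki) //=; last by rewrite ltnS ltnW.
  by rewrite -j_def (inj_eq val_inj) (negPf ij).
move/eqP; rewrite mulf_eq0 => /orP[|/eqP //].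
by rewrite (negPf (sB k' j _)).
Qed.

(** The zeroth coordinate of [u] is nonzero, so some multiple of [u] cancels that of [v]; the
    difference is then zero by the recursion. *)
Lemma irreducible_tridiagonal_eigenline (K : fieldType) (V : vectType K)
    (e : (\dim {:V}).-tuple V) (B : 'End(V)) (u v : V) (a : K) :
    basis_of {:V} e -> irreducible_tridiagonal (repr_mx e B) ->
    B u = a *: u -> B v = a *: v -> u != 0 -> exists c, v = c *: u.
Proof.
move=> be tB Bu Bv u0.
have n0 : (0 < \dim {:V})%N.
  rewrite lt0n; apply: contra u0; rewrite dimv_eq0 => /eqP V0.
  by rewrite -memv0 -V0 memvf.
pose i0 := Ordinal n0.
have cu : coord e i0 u != 0.
  apply: contra u0 => /eqP cu; apply/eqP.
  exact: (@irreducible_tridiagonal_eigen0 _ _ e B u a i0).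
exists (coord e i0 v / coord e i0 u); apply/eqP; rewrite -subr_eq0; apply/eqP.
apply: (@irreducible_tridiagonal_eigen0 _ _ e B _ a i0) => //.
  by rewrite linearB linearZ /= Bu Bv scalerBr !scalerA mulrC.
by rewrite linearB linearZ /= divfK ?subrr.
Qed.

(** * Ends of a standard basis *)

(* In an [A]-standard basis [B] maps an inner vector outside every
   [A]-invariant plane containing it; this singles out the two ends. *)
Definition end_vector (K : fieldType) (V : vectType K) (A B : 'End(V)) (v : V) :
    Prop :=
  v != 0 /\ exists w a b c s t,
    [/\ A v = a *: v, B v = b *: v + c *: w & A w = s *: v + t *: w].

Definition end_lines (K : fieldType) (V : vectType K) (e : (\dim {:V}).-tuple V)
    : {vspace V} * {vspace V} :=
  (<[e`_0]>%VS, <[e`_(\dim {:V}).-1]>%VS).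

(** With respect to [f] the map [A] is irreducible tridiagonal, so its eigenspaces are lines, and
    vectors of [e] span them. Writing [A_standard (B, A)], which is convertible with
    [Astar_standard (A, B)], lets [A] and [B] exchange roles later. *)
Lemma eigenvector_standard (K : fieldType) (V : vectType K) (A B : 'End(V))
    (e f : (\dim {:V}).-tuple V) (v : V) (a : K) :
    A_standard (A, B) e -> A_standard (B, A) f -> v != 0 -> A v = a *: v ->
  exists i : 'I_(\dim {:V}), exists2 c, c != 0 & v = c *: e`_i.
Proof.
case=> /= be dA _ [/= bf _ tA] v0 Av.
have [i ci|c0] := pickP (fun i => coord e i v != 0); last first.
  case/eqP: v0; apply: (basis_ext be) => i; rewrite linear0.
  by apply/eqP; have /negbT := c0 i; rewrite negbK.
have aE : repr_mx e A i i = a.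
  have := congr1 (coord e i) Av.
  by rewrite coord_diag // linearZ /= => /(mulIf ci).
have [|c vE] := irreducible_tridiagonal_eigenline bf tA _ Av (basis_neq0 i be).
  by rewrite diag_basis // aE.
by exists i, c => //; apply: contra v0; rewrite vE => /eqP->; rewrite scale0r.
Qed.

Lemma standard_eigenvalue_inj (K : fieldType) (V : vectType K) (A B : 'End(V))
    (e f : (\dim {:V}).-tuple V) (i j : 'I_(\dim {:V})) :
    A_standard (A, B) e -> A_standard (B, A) f ->
  repr_mx e A i i = repr_mx e A j j -> i = j.
Proof.
case=> /= be dA _ [/= bf _ tA] aij.
have [] := irreducible_tridiagonal_eigenline (u := e`_i) (v := e`_j) bf tA
  (diag_basis i be dA) _ (basis_neq0 i be); first by rewrite aij diag_basis.
move=> c /(congr1 (coord e j)).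
rewrite linearZ /= !coord_free ?(basis_free be) // eqxx.
by case: eqP => // _ /eqP; rewrite mulr0 oner_eq0.
Qed.

(** The vector [v] spans the line of some basis vector of index [k]. If [k] were inner, both
    neighbours would have [A]-eigenvalue [t], but distinct indices have distinct eigenvalues. *)
Lemma end_vector_line (K : fieldType) (V : vectType K) (A B : 'End(V))
    (e f : (\dim {:V}).-tuple V) (v : V) :
    A_standard (A, B) e -> A_standard (B, A) f -> end_vector A B v ->
  <[v]>%VS \in [:: (end_lines e).1; (end_lines e).2].
Proof.
move=> eAB fBA [v0 [w [a [b [c [s [t [Av Bv Aw]]]]]]]].
have [k [d d0 vE]] := eigenvector_standard eAB fBA v0 Av.
have [/= be dA [tB lB uB]] := eAB.
(* Away from [k] the vector [v] has no coordinate, so a nonzero entry of [B] there comes from [w],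
   and the equation for [A w] makes [t] the eigenvalue. *)
have adj j : j != k -> repr_mx e B j k != 0 -> repr_mx e A j j = t.
  move=> jk Bjk; have cv : coord e j v = 0.
    rewrite vE linearZ /= coord_free ?(basis_free be) //.
    by rewrite eq_sym (negPf jk) mulr0.
  have cw : c * coord e j w = d * repr_mx e B j k.
    have := congr1 (coord e j) Bv.
    rewrite linearD !linearZ /= cv mulr0 add0r => <-.
    by rewrite vE !linearZ mxE.
  have := congr1 (coord e j) Aw; rewrite linearD !linearZ /= cv mulr0 add0r.
  rewrite coord_diag //; apply: mulIf; apply/eqP => w0.
  by move/eqP: cw; rewrite w0 mulr0 eq_sym mulf_eq0 (negPf d0) (negPf Bjk).
have -> : <[v]>%VS = <[e`_k]>%VS by apply: line_eq => //; exists d.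
rewrite !inE /=; have [->|k0] := posnP k; first by rewrite eqxx.
have [kn|kn] := ltnP k.+1 (\dim {:V}); last first.
  suff -> : (\dim {:V}).-1 = k by rewrite eqxx orbT.
  suff /(congr1 predn) : \dim {:V} = k.+1 by [].
  by apply/eqP; rewrite eqn_leq ltn_ord kn.
have kp : (k.-1 < \dim {:V})%N by rewrite (leq_ltn_trans (leq_pred k)).
pose i := Ordinal kp; pose j := Ordinal kn.
have ik : i != k by rewrite -(inj_eq val_inj) /= neq_ltn prednK ?leqnn.
have jk : j != k by rewrite -(inj_eq val_inj) /= neq_ltn leqnn orbT.
have aij : repr_mx e A i i = repr_mx e A j j.
  rewrite (adj i) ?(adj j) //; first exact: lB.
  by apply: uB; rewrite /= prednK.
have /(congr1 val)/= kE := standard_eigenvalue_inj eAB fBA aij.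
by have := leq_pred k; rewrite kE ltnn.
Qed.

(** * Ends of a split basis *)

Lemma bidiagonal_column (K : fieldType) (V : vectType K) (A : 'End(V))
    (e : (\dim {:V}).-tuple V) (i j : 'I_(\dim {:V})) :
    basis_of {:V} e -> i != j ->
    (forall k, repr_mx e A k j != 0 -> (k == j) || (k == i)) ->
  A e`_j = repr_mx e A j j *: e`_j + repr_mx e A i j *: e`_i.
Proof.
move=> be ij sA; apply: (basis_ext be) => k.
rewrite linearD !linearZ /= !coord_free ?(basis_free be) //.
have -> : coord e k (A e`_j) = repr_mx e A k j by rewrite mxE.
have [->|kj] := eqVneq k j.
  by rewrite (negPf ij) mulr0 mulr1 addr0.
have [->|ki] := eqVneq k i; first by rewrite mulr0 mulr1 add0r.
rewrite !mulr0 addr0; apply/eqP; apply: contraTT isT => /sA.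
by rewrite (negPf kj) (negPf ki).
Qed.

(** The basis vectors of indices [i] and [j] span an [A]-invariant plane that contains the image
    under [B] of the former; the latter serves as [w]. *)
Lemma end_vector_basis (K : fieldType) (V : vectType K) (A B : 'End(V))
    (e : (\dim {:V}).-tuple V) (i j : 'I_(\dim {:V})) :
    basis_of {:V} e -> i != j ->
    (forall k, repr_mx e A k i != 0 -> k == i) ->
    (forall k, repr_mx e B k i != 0 -> (k == i) || (k == j)) ->
    (forall k, repr_mx e A k j != 0 -> (k == j) || (k == i)) ->
  end_vector A B e`_i.
Proof.
move=> be ij Ai Bi Aj; split; first exact: basis_neq0.
have ji : j != i by rewrite eq_sym.
exists e`_j, (repr_mx e A i i), (repr_mx e B i i), (repr_mx e B j i),
  (repr_mx e A i j), (repr_mx e A j j).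
split; last by rewrite addrC; apply: bidiagonal_column.
  rewrite (bidiagonal_column be ji) => [|k /Ai -> //].
  have [->|/Ai] := eqVneq (repr_mx e A j i) 0; first by rewrite scale0r addr0.
  by rewrite (negPf ji).
exact: bidiagonal_column.
Qed.

(** In the column convention a lower bidiagonal map sends a basis vector into the span of itself and
    its successor, an upper bidiagonal one into that of itself and its predecessor. The invariant
    planes are spanned by the first two and the last two vectors. *)
Lemma split_end_vectors (K : fieldType) (V : vectType K) (A B : 'End(V))
    (e : (\dim {:V}).-tuple V) :
    (2 <= \dim {:V})%N -> basis_of {:V} e ->
    lower_bidiagonal (repr_mx e A) -> upper_bidiagonal (repr_mx e B) ->
  end_vector B A e`_0 /\ end_vector A B e`_(\dim {:V}).-1.
Proof.
move=> n2 be lA uB.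
have uB' k j : repr_mx e B k j != 0 -> (j == k :> nat) || (j == k.+1 :> nat).
  by move=> Bkj; apply: uB; rewrite mxE.
have n0 : (0 < \dim {:V})%N by apply: leq_trans n2.
have nP : (\dim {:V}).-1.+1 = \dim {:V} by rewrite prednK.
have nPP : (\dim {:V}).-2.+1 = (\dim {:V}).-1.
  by rewrite prednK // -ltnS nP.
have lt1 : ((\dim {:V}).-1 < \dim {:V})%N by rewrite nP.
have lt2 : ((\dim {:V}).-2 < \dim {:V})%N.
  by rewrite (leq_ltn_trans (leq_pred _)).
split.
  (* [Ordinal n2] is the index 1, since [n2] also reads as a strict inequality. *)
  apply: (@end_vector_basis _ _ _ _ _ (Ordinal n0) (Ordinal n2)) => // k.
  - by move=> /uB' /=; rewrite orbF eq_sym.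
  - exact: lA.
  - by move=> /uB' /=; rewrite eqSS ![_ == k :> nat]eq_sym.
apply: (@end_vector_basis _ _ _ _ _ (Ordinal lt1) (Ordinal lt2)) => //.
- by rewrite -(inj_eq val_inj) /= -nPP gtn_eqF.
- move=> k /lA /= /orP[//|/eqP kn].
  by have := ltn_ord k; rewrite kn nP ltnn.
- move=> k /uB' /=; rewrite -{2}nPP eqSS ![_ == k :> nat]eq_sym.
  by rewrite -!(inj_eq val_inj).
- by move=> k /lA /=; rewrite nPP.
Qed.

(** * The four end lines are distinct *)

(** A line common to [e] and [f] would consist of eigenvectors of [B], yet [B] gives each vector of
    [e] a nonzero component along a neighbour. *)
Lemma end_lines_uniq (K : fieldType) (V : vectType K) (A B : 'End(V))
    (e f : (\dim {:V}).-tuple V) :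
    (2 <= \dim {:V})%N -> A_standard (A, B) e -> A_standard (B, A) f ->
  uniq [:: (end_lines e).1; (end_lines e).2; (end_lines f).1; (end_lines f).2].
Proof.
move=> n2 eAB fBA; have [/= be dA [tB lB uB]] := eAB; have [/= bf dB _] := fBA.
have n0 : (0 < \dim {:V})%N by apply: leq_trans n2.
have lt1 : ((\dim {:V}).-1 < \dim {:V})%N by rewrite prednK.
have neq_line (g : (\dim {:V}).-tuple V) (i j : 'I_(\dim {:V})) :
    basis_of {:V} g -> i != j -> <[g`_i]>%VS != <[g`_j]>%VS.
  move=> bg ij; apply/eqP => gij.
  have /vlineP[c] : g`_i \in <[g`_j]>%VS by rewrite -gij memv_line.
  move=> /(congr1 (coord g i)); rewrite linearZ /=.
  rewrite !coord_free ?(basis_free bg) // eqxx [j == i]eq_sym (negPf ij).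
  by rewrite mulr0 => /eqP; rewrite oner_eq0.
have ef (i j : 'I_(\dim {:V})) : <[e`_i]>%VS != <[f`_j]>%VS.
  apply/eqP => eij; have /vlineP[c eE] : e`_i \in <[f`_j]>%VS.
    by rewrite -eij memv_line.
  have Be : B e`_i = repr_mx e B i i *: e`_i.
    have Bb : B e`_i = repr_mx f B j j *: e`_i.
      by rewrite eE linearZ /= (diag_basis _ bf dB) !scalerA mulrC.
    by rewrite mxE Bb linearZ /= coord_free ?(basis_free be) // eqxx mulr1.
  (* The neighbour is the successor of [i] if there is one, otherwise the predecessor, which exists
     in dimension at least 2. *)
  have [k ki Bki] : exists2 k : 'I_(\dim {:V}), k != i & repr_mx e B k i != 0.
    have [i1|i1] := ltnP i.+1 (\dim {:V}).
      exists (Ordinal i1); first by rewrite -(inj_eq val_inj) /= gtn_eqF.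
      exact: lB.
    have i0 : (0 < i)%N by rewrite -ltnS (leq_trans n2).
    have i2 : (i.-1 < \dim {:V})%N by rewrite (leq_ltn_trans (leq_pred i)).
    exists (Ordinal i2).
      by rewrite -(inj_eq val_inj) /= neq_ltn prednK ?leqnn.
    by apply: uB; rewrite /= prednK.
  case/eqP: Bki; rewrite mxE Be linearZ /= coord_free ?(basis_free be) //.
  by rewrite eq_sym (negPf ki) mulr0.
have o01 : Ordinal n0 != Ordinal lt1.
  by rewrite -(inj_eq val_inj) /= ltn_eqF // -ltnS prednK.
rewrite /= !inE !negb_or (neq_line _ _ _ be o01) (neq_line _ _ _ bf o01).
by rewrite !(ef (Ordinal _) (Ordinal _)).
Qed.

(** * Perfect matchings of four points *)

(* [((a, b), (c, d))] encodes the perfect matching with edges ab and cd. *)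
Definition is_edge (T : eqType) (m : (T * T) * (T * T)) (x y : T) : bool :=
  (x, y) \in [:: m.1; m.2; (m.1.2, m.1.1); (m.2.2, m.2.1)].

(** Either order of the endpoints is allowed, because a split basis may start at an end of either
    kind. *)
Definition crosses (T : eqType) (m : (T * T) * (T * T)) (x : T * T) : bool :=
  (x.1 \in [:: m.1.1; m.1.2]) && (x.2 \in [:: m.2.1; m.2.2]) ||
  (x.1 \in [:: m.2.1; m.2.2]) && (x.2 \in [:: m.1.1; m.1.2]).

Definition vertices (T : eqType) (m : (T * T) * (T * T)) : seq T :=
  [:: m.1.1; m.1.2; m.2.1; m.2.2].

Lemma crossesC (T : eqType) (m : (T * T) * (T * T)) (x y : T) :
  crosses m (x, y) = crosses m (y, x).
Proof. by rewrite /crosses orbC ![(x \in _) && _]andbC. Qed.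

(** The edge [x y] of [m] has an endpoint on each edge of [n], and the edges of [n] are disjoint. *)
Lemma crosses_not_edge (T : eqType) (m n : (T * T) * (T * T)) (x y : T) :
  uniq (vertices n) -> crosses n m.1 -> crosses n m.2 -> is_edge m x y ->
  ~~ is_edge n x y.
Proof.
case: m n => [[a b] [c d]] [[p q] [r s]] un c1 c2 mxy; apply/negP => nxy.
have {c1 c2 mxy} cxy : crosses (p, q, (r, s)) (x, y).
  move: mxy c1 c2; rewrite /is_edge !inE.
  by move=> /or4P[] /eqP[-> ->] //; rewrite crossesC.
have dis z : z \in [:: p; q] -> z \in [:: r; s] -> False.
  move: un; rewrite /vertices -[[:: _; _; _; _]]/([:: p; q] ++ [:: r; s]).
  by rewrite cat_uniq => /and3P[_ /hasPn pq _] zp /pq; rewrite /= zp.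
have : (x \in [:: p; q]) && (y \in [:: p; q]) ||
       (x \in [:: r; s]) && (y \in [:: r; s]).
  move: nxy; rewrite /is_edge !inE.
  by move=> /or4P[] /eqP[-> ->]; rewrite ?eqxx ?orbT.
by move: cxy => /orP[] /andP[xm ym] /orP[] /andP[xn yn];
   by [apply: (dis x) | apply: (dis y)].
Qed.

(** The vertex [m.1.1] lies on some edge of [n]. That edge joins the two edges of [m], so its other
    endpoint is on [m.2]. *)
Lemma crosses_edge (T : eqType) (m n : (T * T) * (T * T)) :
  uniq (vertices m) -> crosses n m.1 -> crosses m n.1 -> crosses m n.2 ->
  is_edge n m.1.1 m.2.1 || is_edge n m.1.1 m.2.2.
Proof.
case: m n => [[a b] [c d]] [[p q] [r s]] um.
have dis : (a \in [:: c; d]) = false.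
  move: um => /= /and4P[]; rewrite !inE !negb_or.
  by case/and3P=> _ /negPf-> /negPf->.
rewrite /crosses /is_edge /= => c1.
have {c1} : [|| a == p, a == q, a == r | a == s].
  by move: c1; rewrite !inE => /orP[] /andP[/orP[] -> _]; rewrite ?orbT.
case/or4P=> /eqP <-; rewrite dis ?andbF ?orbF /=.
- by move=> /andP[_]; rewrite !inE => /orP[] /eqP-> _; rewrite eqxx ?orbT.
- by move=> /andP[+ _]; rewrite !inE => /orP[] /eqP-> _; rewrite eqxx ?orbT.
- by move=> _ /andP[_]; rewrite !inE => /orP[] /eqP->; rewrite eqxx ?orbT.
- by move=> _ /andP[+ _]; rewrite !inE => /orP[] /eqP->; rewrite eqxx ?orbT.
Qed.

(** Given four matchings, a fixed vertex of the first has only two possible partners in the other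
    three, so two of these share an edge. *)
Lemma crossing_matchings_le3 (I T : eqType) (s : seq I)
    (R : I -> (T * T) * (T * T) -> Prop) :
    uniq s -> (forall p, p \in s -> exists2 m, R p m & uniq (vertices m)) ->
    (forall p q m n, p \in s -> q \in s -> p != q -> R p m -> R q n ->
      crosses n m.1 /\ crosses n m.2) ->
  (size s <= 3)%N.
Proof.
move=> hs ends cross.
have no_common p q m n x y : p \in s -> q \in s -> p != q ->
    R p m -> R q n -> uniq (vertices n) ->
    is_edge m x y -> is_edge n x y -> False.
  move=> ps qs pq pm qn un mxy; apply/negP.
  have [c1 c2] := cross p q m n ps qs pq pm qn.
  exact: (crosses_not_edge un c1 c2 mxy).
case: s hs ends cross no_common => [|p0 [|p1 [|p2 [|p3 s]]]] //=.
rewrite !inE !negb_or => /and5P[/and4P[p01 p02 p03 _] /and3P[p12 p13 _]].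
case/andP=> p23 _ _ _ ends cross no_common.
have s0 : p0 \in [:: p0, p1, p2, p3 & s] by rewrite !inE eqxx.
have s1 : p1 \in [:: p0, p1, p2, p3 & s] by rewrite !inE eqxx !orbT.
have s2 : p2 \in [:: p0, p1, p2, p3 & s] by rewrite !inE eqxx !orbT.
have s3 : p3 \in [:: p0, p1, p2, p3 & s] by rewrite !inE eqxx !orbT.
have [[m0 e0 u0] [m1 e1 u1] [m2 e2 u2] [m3 e3 u3]] :=
  And4 (ends _ s0) (ends _ s1) (ends _ s2) (ends _ s3).
have edge p m : p \in [:: p0, p1, p2, p3 & s] -> p0 != p -> R p m ->
    is_edge m m0.1.1 m0.2.1 || is_edge m m0.1.1 m0.2.2.
  move=> ps p0p pm; have [c _] := cross p0 p m0 m s0 ps p0p e0 pm.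
  have [|d1 d2] := cross p p0 m m0 ps s0 _ pm e0; first by rewrite eq_sym.
  exact: crosses_edge u0 c d1 d2.
have := edge p3 m3 s3 p03 e3; have := edge p2 m2 s2 p02 e2.
have := edge p1 m1 s1 p01 e1.
have nc12 x y := no_common p1 p2 m1 m2 x y s1 s2 p12 e1 e2 u2.
have nc13 x y := no_common p1 p3 m1 m3 x y s1 s3 p13 e1 e3 u3.
have nc23 x y := no_common p2 p3 m2 m3 x y s2 s3 p23 e2 e3 u3.
(* Pigeonhole: three matchings choose between two edges. *)
by move=> /orP[] E1 /orP[] E2 /orP[] E3;
   by [case: (nc12 _ _ E1 E2) | case: (nc13 _ _ E1 E3)
      | case: (nc23 _ _ E2 E3)].
Qed.

(** * From Leonard pairs to matchings *)

(** This is a relation because the ordered ends depend on the chosen bases: reversing a basis swaps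
    its ends. *)
Definition standard_ends (K : fieldType) (V : vectType K)
    (p : 'End(V) * 'End(V))
    (m : ({vspace V} * {vspace V}) * ({vspace V} * {vspace V})) : Prop :=
  exists e f, [/\ A_standard p e, Astar_standard p f
    & m = (end_lines e, end_lines f)].

(** The first and last vectors of [e] are end vectors for [q] of opposite kinds; which is which
    depends on which map is lower bidiagonal. *)
Lemma split_basis_crosses (K : fieldType) (V : vectType K)
    (q : 'End(V) * 'End(V)) (e : (\dim {:V}).-tuple V) n :
    (2 <= \dim {:V})%N -> standard_ends q n -> split_basis q e ->
  crosses n (end_lines e).
Proof.
case: q => A B n2 [f [g [fAB gBA ->]]] [be sAB]; rewrite /crosses /=.
have endA := end_vector_line (A := A) (B := B) fAB gBA.
have endB := end_vector_line (A := B) (B := A) gBA fAB.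
case: sAB => -[sA sB].
  by have [/endB -> /endA ->] := split_end_vectors n2 be sA sB; rewrite orbT.
by have [/endA -> /endB ->] := split_end_vectors n2 be sB sA.
Qed.

Lemma adjacent_crosses (K : fieldType) (V : vectType K)
    (p q : 'End(V) * 'End(V)) m n :
    (2 <= \dim {:V})%N -> standard_ends p m -> standard_ends q n ->
    adjacent p q ->
  crosses n m.1 /\ crosses n m.2.
Proof.
move=> n2 [e [f [pe pf ->]]] qn [pq _].
by split; apply: split_basis_crosses qn _ => //; apply: pq; [left | right].
Qed.

Theorem theorem4p6 (K : fieldType) (hK : [pchar K] =i pred0)
    (V : vectType K) (hV : (2 <= \dim {:V})%N)
    (s : seq ('End(V) * 'End(V))) (hs : uniq s)
    (hL : forall p, p \in s -> leonard_pair p)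
    (hadj : mutually_adjacent s) :
  (size s <= 3)%N.
Proof.
have ends p : p \in s -> exists2 m, standard_ends p m & uniq (vertices m).
  case: p => A B /hL[[e pe] [f pf]].
  exists (end_lines e, end_lines f); first by exists e, f.
  exact: (end_lines_uniq hV pe pf).
apply: crossing_matchings_le3 hs ends _ => p q m n ps qs pq pm qn.
exact: adjacent_crosses hV pm qn (hadj _ _ ps qs pq).
Qed.
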